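(* Let $M\in\mathbb{R}^{n\times n}$ be symmetric positive definite and let $A,B\in\mathbb{R}^{n\times n}$. Let $\tilde s$ be the projection of a vector $s\in\mathbb{R}^n$ onto $\ker(B-A)^{\perp_{M^{-2}}}$ (orthogonal with respect to $\langle\cdot,\cdot\rangle_{M^{-2}}$), and assume $\tilde s\ne0$. Then $$\frac{\|M(B-A)s\|_2^2}{\|M^{-1}s\|_2^2}\le\frac{\|M(B-A)\tilde s\|_2^2}{\|M^{-1}\tilde s\|_2^2},$$ with equality if and only if $s\in\ker(B-A)^{\perp_{M^{-2}}}$.
   Context: For a symmetric positive definite $W$, $\langle a,b\rangle_W=a^\top Wb$, and for a subspace $V\subseteq\mathbb{R}^n$, $V^{\perp_W}=\{z:\langle z,x\rangle_W=0\ \forall x\in V\}$. Projection onto $V^{\perp_W}$ means the orthogonal projection with respect to $\langle\cdot,\cdot\rangle_W$; here $W=M^{-2}$. (The left-hand quantity is the guaranteed decrease of the weighted error $\|M(B-A)M\|_F^2$ under a generalized PSB update in direction $s$.) *)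

(* Defs.v *)
From mathcomp Require Import all_boot all_order all_algebra.
Set Implicit Arguments.
Unset Strict Implicit.
Unset Printing Implicit Defensive.
Import Order.TTheory GRing.Theory Num.Theory.
Local Open Scope ring_scope.

Definition norm2 (R : rcfType) (n : nat) (x : 'cV[R]_n) : R :=
  Num.sqrt (\sum_(i < n) x i 0 ^+ 2).

Definition wdot (R : rcfType) (n : nat) (W : 'M[R]_n) (a b : 'cV[R]_n) : R :=
  (a^T *m W *m b) 0 0.

Definition symposdef (R : rcfType) (n : nat) (M : 'M[R]_n) : Prop :=
  M^T = M /\ forall x : 'cV[R]_n, x != 0 -> 0 < (x^T *m M *m x) 0 0.

(* The matrix acts on column vectors, whereas [kermx] is the kernel of the
   action on row vectors. *)
Definition mxker (R : rcfType) (n : nat) (C : 'M[R]_n) : {vspace 'cV[R]_n} :=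
  lker (linfun (mulmx C : 'cV[R]_n -> 'cV[R]_n)).

Definition wperp (R : rcfType) (n : nat) (W : 'M[R]_n)
    (V : {vspace 'cV[R]_n}) (z : 'cV[R]_n) : Prop :=
  forall x : 'cV[R]_n, x \in V -> wdot W z x = 0.

(* [t] is the W-orthogonal projection of [s] onto the subspace [U]; such a [t]
   exists and is unique when W is symmetric positive definite. *)
Definition is_wproj (R : rcfType) (n : nat) (W : 'M[R]_n)
    (U : 'cV[R]_n -> Prop) (s t : 'cV[R]_n) : Prop :=
  U t /\ forall u : 'cV[R]_n, U u -> wdot W (s - t) u = 0.

(* Main.v *)
Require Import Defs.
From mathcomp Require Import all_boot all_order all_algebra.
Import Order.TTheory GRing.Theory Num.Theory.
Local Open Scope ring_scope.
Set Implicit Arguments.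
Unset Strict Implicit.

(** With C = B - A and d = s - st, the orthogonality of d to every M^2 C^T y,
    all of which lie in the W-complement of ker C, forces C d = 0.  Hence
    C s = C st, while Pythagoras gives |M^-1 s|^2 = |M^-1 st|^2 + |M^-1 d|^2:
    the two quotients share their numerator, which is nonzero since
    st <> 0 is W-orthogonal to ker C, and only the denominators differ. *)

Lemma norm2_sqr (R : rcfType) (n : nat) (x : 'cV[R]_n) :
  norm2 x ^+ 2 = (x^T *m x) 0 0.
Proof.
rewrite /norm2 sqr_sqrtr; last by apply: sumr_ge0 => i _; exact: sqr_ge0.
by rewrite mxE; apply: eq_bigr => i _; rewrite mxE expr2.
Qed.

Lemma norm2_sqr_eq0 (R : rcfType) (n : nat) (x : 'cV[R]_n) :
  (norm2 x ^+ 2 == 0) = (x == 0).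
Proof.
apply/idP/eqP => [|->]; last by rewrite norm2_sqr mulmx0 mxE.
rewrite /norm2 sqr_sqrtr; last by apply: sumr_ge0 => i _; exact: sqr_ge0.
rewrite psumr_eq0 => [/allP x0|i _]; last exact: sqr_ge0.
apply/colP => i; rewrite mxE; apply/eqP.
by rewrite -sqrf_eq0; apply: x0; rewrite mem_index_enum.
Qed.

(** A singular [M] would have a nonzero row vector [v] with [v *m M = 0], and the quadratic form
    would then vanish at [v^T]. *)
Lemma symposdef_unitmx (R : rcfType) (n : nat) (M : 'M[R]_n) :
  symposdef M -> M \in unitmx.
Proof.
case=> _ Mpos; rewrite unitmxE unitfE; apply/negP => /det0P [v v0 vM].
have := Mpos v^T; rewrite trmx_eq0 => /(_ v0).
by rewrite trmxK vM mul0mx mxE ltxx.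
Qed.

Lemma mem_mxker (R : rcfType) (n : nat) (C : 'M[R]_n) (x : 'cV[R]_n) :
  (x \in mxker C) = (C *m x == 0).
Proof. by rewrite /mxker memv_ker lfunE. Qed.

Lemma wdotDl (R : rcfType) (n : nat) (W : 'M[R]_n) (a b c : 'cV[R]_n) :
  wdot W (a + b) c = wdot W a c + wdot W b c.
Proof. by rewrite /wdot linearD /= !mulmxDl mxE. Qed.

Lemma wdotDr (R : rcfType) (n : nat) (W : 'M[R]_n) (a b c : 'cV[R]_n) :
  wdot W a (b + c) = wdot W a b + wdot W a c.
Proof. by rewrite /wdot mulmxDr mxE. Qed.

Lemma wdotC (R : rcfType) (n : nat) (W : 'M[R]_n) (a b : 'cV[R]_n) :
  W^T = W -> wdot W a b = wdot W b a.
Proof.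
move=> WT; rewrite /wdot.
have <- : (b^T *m W *m a)^T = a^T *m W *m b.
  by rewrite !trmx_mul trmxK WT mulmxA.
by rewrite mxE.
Qed.

(** Used with the symmetric [N = invmx M], it turns the [M^-2] inner product into the squared norms
    of the denominators. *)
Lemma wdot_trmx_mul (R : rcfType) (n : nat) (N : 'M[R]_n) (x : 'cV[R]_n) :
  wdot (N^T *m N) x x = norm2 (N *m x) ^+ 2.
Proof. by rewrite norm2_sqr /wdot trmx_mul !mulmxA. Qed.

(** By symmetry the weight cancels its inverse, so pairing with [x] leaves [(C *m x)^T *m y], which
    is zero on the kernel. *)
Lemma wperp_trmx_mul (R : rcfType) (n : nat) (W C : 'M[R]_n) (y : 'cV[R]_n) :
  W \in unitmx -> W^T = W -> wperp W (mxker C) (invmx W *m C^T *m y).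
Proof.
move=> Wu WT x; rewrite mem_mxker => /eqP Cx0.
rewrite wdotC // /wdot !mulmxA mulmxK // -trmx_mul Cx0.
by rewrite trmx0 mul0mx mxE.
Qed.

Lemma wperp_wperp_mxker (R : rcfType) (n : nat) (W C : 'M[R]_n)
    (d : 'cV[R]_n) :
  W \in unitmx -> W^T = W ->
  (forall u, wperp W (mxker C) u -> wdot W d u = 0) -> d \in mxker C.
Proof.
(* The choice [y = C *m d] makes the pairing of [d] with the test vector equal to the squared norm
   of [C *m d]. *)
move=> Wu WT /(_ _ (wperp_trmx_mul (C *m d) Wu WT)).
rewrite /wdot !mulmxA mulmxK // -trmx_mul -mulmxA -norm2_sqr => /eqP.
by rewrite norm2_sqr_eq0 mem_mxker.
Qed.

Unset Implicit Arguments.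
Set Strict Implicit.

Theorem theorem3p15 (R : rcfType) (n : nat) (M A B : 'M[R]_n)
    (s st : 'cV[R]_n)
    (hM : symposdef M)
    (hst : is_wproj (invmx M *m invmx M)
             (wperp (invmx M *m invmx M) (mxker (B - A))) s st)
    (hst0 : st != 0) :
  norm2 (M *m (B - A) *m s) ^+ 2 / norm2 (invmx M *m s) ^+ 2
    <= norm2 (M *m (B - A) *m st) ^+ 2 / norm2 (invmx M *m st) ^+ 2
  /\ (norm2 (M *m (B - A) *m s) ^+ 2 / norm2 (invmx M *m s) ^+ 2
        = norm2 (M *m (B - A) *m st) ^+ 2 / norm2 (invmx M *m st) ^+ 2
      <-> wperp (invmx M *m invmx M) (mxker (B - A)) s).
Proof.
have Mu := symposdef_unitmx hM; case: hM => MT _.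
have NT : (invmx M)^T = invmx M by rewrite trmx_inv MT.
have Nu : invmx M \in unitmx by rewrite unitmx_inv.
move: hst; set N := invmx M in NT Nu *; set W := N *m N; set C := B - A.
have WT : W^T = W by rewrite /W trmx_mul NT.
have Wu : W \in unitmx by rewrite unitmx_mul Nu.
have WE x : wdot W x x = norm2 (N *m x) ^+ 2 by rewrite -wdot_trmx_mul NT.
have N0 x : (norm2 (N *m x) ^+ 2 == 0) = (x == 0).
  rewrite norm2_sqr_eq0; apply/eqP/eqP => [Nx0|->]; last by rewrite mulmx0.
  by rewrite -[x](mulKmx Nu) Nx0 mulmx0.
case=> st_perp d_perp; have dV := wperp_wperp_mxker Wu WT d_perp.
move: dV {d_perp}; set d := s - st => dV.
have sE : s = st + d by rewrite /d addrC subrK.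
clearbody d.
have Cs : C *m s = C *m st.
  by rewrite sE mulmxDr; move: dV; rewrite mem_mxker => /eqP ->; rewrite addr0.
have std0 : wdot W st d = 0 by exact: st_perp.
have pyth : norm2 (N *m s) ^+ 2
    = norm2 (N *m st) ^+ 2 + norm2 (N *m d) ^+ 2.
  by rewrite -!WE {1 2}sE wdotDl !wdotDr (wdotC d st) // std0 addr0 add0r.
have st_gt0 : 0 < norm2 (N *m st) ^+ 2 by rewrite lt_def N0 hst0 sqr_ge0.
have d_ge0 : 0 <= norm2 (N *m d) ^+ 2 by exact: sqr_ge0.
have num_neq0 : norm2 (M *m C *m st) ^+ 2 != 0.
  rewrite norm2_sqr_eq0; apply/eqP => MCst0.
  have stV : st \in mxker C.
    by rewrite mem_mxker -(mulKmx Mu (C *m st)) [M *m _]mulmxA MCst0 mulmx0.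
  by move: hst0; rewrite -N0 -WE st_perp // eqxx.
(* Inverting the inequality between denominators requires both to be positive; this also keeps the
   left quotient away from the default value of division by zero. *)
have s_gt0 : 0 < norm2 (N *m s) ^+ 2 by rewrite pyth ltr_wpDr.
rewrite -!mulmxA Cs !mulmxA; split.
  by rewrite ler_wpM2l ?sqr_ge0 // lef_pV2 ?posrE // pyth lerDl.
(* Cancelling the common nonzero numerator equates the denominators, so by [pyth] the [d] term
   vanishes and [s = st]. *)
split=> [/(mulfI num_neq0)/invr_inj/eqP|s_perp].
  rewrite pyth -subr_eq0 addrAC subrr add0r N0 => /eqP d0.
  by rewrite sE d0 addr0.
(* Conversely, [d] lies in the kernel, so it is orthogonal to both [s] and [st], hence to itself. *)
have /eqP : wdot W d d = 0.
  by have := s_perp _ dV; rewrite {1}sE wdotDl std0 add0r.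
by rewrite WE N0 sE => /eqP ->; rewrite addr0.
Qed.
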